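(* Let $K_1,\dots,K_m\subset\mathbb{R}^2$ be compact convex sets which are centrally symmetric (i.e. $K_i=-K_i$), and let $q\ge0$ be an integer. Then $\int_{\lambda_1K_1+\dots+\lambda_mK_m}|s|^{2q}\,ds$ is a polynomial in $\lambda_1,\dots,\lambda_m\ge0$ with nonnegative coefficients.
   Context: $\lambda_1K_1+\dots+\lambda_mK_m$ denotes the Minkowski sum; $|\cdot|$ the Euclidean norm; $ds$ planar Lebesgue measure. *)

(* Defs.v *)
From HB Require Import structures.
From mathcomp Require Import all_boot all_order all_algebra.
From mathcomp Require Import all_classical all_reals all_analysis.
Set Implicit Arguments. Unset Strict Implicit. Unset Printing Implicit Defensive.
Import Order.TTheory GRing.Theory Num.Theory.
Import numFieldNormedType.Exports.
Local Open Scope classical_set_scope.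
Local Open Scope ring_scope.

(* Points of the plane R^2 are pairs (x, y) : R * R, with the product topology
   and the product sigma-algebra. *)

Definition vadd (R : realType) (u v : R * R) : R * R := (u.1 + v.1, u.2 + v.2).
Definition vscale (R : realType) (a : R) (u : R * R) : R * R := (a * u.1, a * u.2).
Definition vopp (R : realType) (u : R * R) : R * R := (- u.1, - u.2).

Definition convex_set2 (R : realType) (K : set (R * R)) : Prop :=
  forall x y, K x -> K y -> forall t : R, 0 <= t -> t <= 1 ->
    K (vadd (vscale t x) (vscale (1 - t) y)).

Definition centrally_symmetric (R : realType) (K : set (R * R)) : Prop :=
  (@vopp R) @` K = K.

Definition minkowski_comb (R : realType) (m : nat)
    (lam : 'I_m -> R) (K : 'I_m -> set (R * R)) : set (R * R) :=
  [set s | exists x : 'I_m -> R * R, (forall i, K i (x i)) /\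
     s = (\sum_(i < m) (lam i * (x i).1), \sum_(i < m) (lam i * (x i).2))].

Definition lebesgue2 (R : realType) :=
  ((@lebesgue_measure R) \x (@lebesgue_measure R))%E.

Definition sqnorm2 (R : realType) (s : R * R) : R := s.1 ^+ 2 + s.2 ^+ 2.

(* Main.v *)
Require Import Defs.
From HB Require Import structures.
From mathcomp Require Import all_boot all_order all_algebra.
From mathcomp Require Import all_classical all_reals all_analysis.
From mathcomp Require Import cyclic separable cyclotomic complex ring lra zify measurable_realfun.
Import Order.TTheory GRing.Theory Num.Theory.
Import numFieldNormedType.Exports.
Local Open Scope classical_set_scope.
Local Open Scope ring_scope.
Set Implicit Arguments.
Unset Strict Implicit.
Unset Printing Implicit Defensive.

(** By averaging over roots of unity, [|s|^2q] is a nonnegative combination of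
    powers [(x + c y)^2q], and a shear turns each of them into [x^2q].  For a
    symmetric convex [L] with largest abscissa [A], vertical edge of length [V] and
    support points [(x(s), y(s))] maximizing [y - s x], slicing vertically gives
      [\int_L x^2q = 2/(2q+1) A^(2q+1) V
         + 2/((2q+1)(2q+2)) \int_R (A^(2q+2) - x(s)^(2q+2)) ds].
    All of [A], [V], [x(s)] are Minkowski linear in [L] and [|x_i(s)| <= A_i], so
    expanding the products yields nonnegative coefficients. *)

(** The obstacle is that the vertical section of a Minkowski sum at a given abscissa is not
    assembled from the sections of the summands at that abscissa. Indexing boundary points by the
    slope [s] of a supporting line makes the data additive instead. The bridge is the support
    function [h s], the maximum of y - s x: it is convex with subgradient [- xs s], so integrals of
    [xs] are differences of [h], and for |t| < A the section at abscissa t has length V + \int_R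
    max(0, A - max(|t|, |x(s)|)) ds. After Tonelli, the integral over t is explicit for each fixed
    s; this is where 2/((2q+1)(2q+2)) comes from. Neither A^(2q+2) nor x(s)^(2q+2) need be
    integrable over R by itself, so products are expanded under the integral sign, each product of
    A_i's staying paired with the product of x_i(s)'s. That the resulting coefficients are finite is
    not visible from their formula; it is deduced from the boundedness of K_1 + ... + K_m. *)

(** * Powers of the norm as combinations of powers of linear forms *)

Lemma closed_field_prim_root (C : numClosedFieldType) (n : nat) :
  (0 < n)%N -> exists z : C, n.-primitive_root z.
Proof.
move=> n_gt0; pose p : {poly C} := 'X^n - 1.
have [r Dp] := closed_field_poly_normal p.
rewrite (monicP _) ?monicXnsubC// scale1r in Dp.
have rn1 : all n.-unity_root r.
  by apply/allP => z; rewrite -root_prod_XsubC -Dp.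
have sz_r : (n < (size r).+1)%N.
  by rewrite -(size_prod_XsubC r id) -Dp size_XnsubC.
(* A primitive root exists among [n] distinct [n]-th roots of unity; distinctness is the
   separability of ['X^n - 1], where characteristic 0 enters. *)
have [|z _ zn] := hasP (has_prim_root n_gt0 rn1 _ sz_r); last by exists z.
by rewrite -separable_prod_XsubC -Dp separable_Xn_sub_1// pnatr_eq0 -lt0n.
Qed.

Lemma sum_unity_root (F : fieldType) (n : nat) (z : F) :
  z ^+ n = 1 -> \sum_(j < n) z ^+ j = if z == 1 then n%:R else 0.
Proof.
case: eqP => [-> _|/eqP z1 zn].
  under eq_bigr do rewrite expr1n.
  by rewrite sumr_const card_ord.
have := subrX1 z n; rewrite zn subrr => /esym/eqP.
by rewrite mulf_eq0 subr_eq0 (negPf z1) => /eqP.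
Qed.

(* Averaging over the odd number [2q+1] of directions avoids the vertical one. *)
Lemma sqnorm_pow_sum_linear_pow (R : rcfType) (q : nat) :
  exists w c : 'I_(q.*2.+1) -> R, (forall j, 0 <= w j) /\
    forall x y : R, (x ^+ 2 + y ^+ 2) ^+ q =
      \sum_(j < q.*2.+1) w j * (x + c j * y) ^+ q.*2.
Proof.
pose N := q.*2.+1.
have [om prim] := @closed_field_prim_root (R[i]) N isT.
have omN : om ^+ N = 1 by exact: prim_expr_order.
have om0 : om != 0.
  by apply/eqP => om0; move: omN; rewrite om0 expr0n => /eqP; rewrite eq_sym oner_eq0.
have om_norm : `|om| = 1.
  by apply/eqP; rewrite -(@pexpr_eq1 _ _ N)// -normrX omN normr1.
pose z j := om ^+ j.
pose a j : R := complex.Re (z j); pose b j : R := complex.Im (z j).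
have zJ j : conjc (z j) = (z j)^-1.
  by rewrite invc_norm normrX om_norm !expr1n invr1 mul1r.
have z0 j : z j != 0 by rewrite expf_neq0.
(* A number of modulus 1 with zero real part has square -1; raising to the odd power [N] would give
   1 = -1. *)
have aE j : a j = 0 -> False.
  move=> aj0; have zz : (z j) ^+ 2 = -1.
    have /eqP := ReJ_add (z j); rewrite -/(a j) aj0 eq_sym mulf_eq0 invr_eq0.
    rewrite pnatr_eq0 orbF zJ addr_eq0 => /eqP zjE.
    by rewrite expr2 {1}zjE mulNr mulVf.
  have := congr1 (fun u => u ^+ N) zz.
  rewrite /= exprAC [z j ^+ N]exprAC omN !expr1n -signr_odd /= odd_double expr1.
  by move=> /eqP; rewrite -addr_eq0 -(natrD _ 1 1) pnatr_eq0.
(* Only the central binomial term survives the sum over directions; it occurs [N] times, and the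
   power of 2 comes from writing a real part as a half sum. *)
pose B : R := 'C(q.*2, q)%:R * N%:R / 2 ^+ q.*2.
have B0 : 0 < B.
  by rewrite divr_gt0 ?exprn_gt0// mulr_gt0 ?ltr0n// bin_gt0 -addnn leq_addr.
have key x y : \sum_(j < N) (a j * x + b j * y) ^+ q.*2 = B * (x ^+ 2 + y ^+ 2) ^+ q.
  apply: complexI; rewrite rmorph_sum/=.
  have [Z ZE] : exists Z, Z = Complex x y by exists (Complex x y).
  have JM u v : conjc (u * v) = conjc u * conjc v :> R[i] by exact: rmorphM.
  (* The linear form is the real part of [conjc Z * z j], the half sum of [conjc Z * z j] and
     [Z / z j]. In its binomial expansion, term [k] depends on [j] only through the [j]-th power of
     a root of unity. *)
  have step j : ((a j * x + b j * y) ^+ q.*2)%:C%C = 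
      2 ^- q.*2 * \sum_(k < q.*2.+1) (conjc Z ^+ (q.*2 - k) * Z ^+ k * (om ^+ (q.*2 - k) / om ^+ k) ^+ j) *+ 'C(q.*2, k).
    have -> : a j * x + b j * y = complex.Re (conjc Z * z j).
      by rewrite ZE /a /b; case: (z j) => u v /=; ring.
    rewrite rmorphXn/= ReJ_add JM conjcK zJ expr_div_n mulrC; congr (_ * _).
    rewrite exprDn; apply: eq_bigr => k _; congr (_ *+ _).
    rewrite !exprMn -!mulrA; congr (_ * _).
    rewrite mulrCA; congr (_ * _).
    by rewrite /z !exprVn -!exprM mulnC [(j * k)%N]mulnC.
  rewrite (eq_bigr _ (fun j _ => step (val j))) -mulr_sumr exchange_big/=.
  have kq : (q < q.*2.+1)%N by rewrite ltnS -addnn leq_addr.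
  rewrite (bigD1 (Ordinal kq))//= [X in _ + X]big1 ?addr0 => [|k kneq].
  - rewrite -addnn addnK addnn.
    under eq_bigr do rewrite divff ?expf_neq0// expr1n mulr1.
    rewrite sumr_const card_ord -exprMn.
    have -> : conjc Z * Z = (x ^+ 2 + y ^+ 2)%:C%C.
      by rewrite mulrC -sqr_normc -add_Re2_Im2 ZE.
    rewrite !rmorphM/= !rmorphXn/= fmorphV rmorphXn/= !rmorph_nat.
    rewrite -(mulr_natr _ N) -(mulr_natr _ (binomial _ _)) /B; ring.
  - rewrite sumrMnl -mulr_sumr sum_unity_root; last first.
      by rewrite expr_div_n -!exprM ![(_ * N)%N]mulnC !exprM omN !expr1n divr1.
    (* The root of unity is 1 only if 2q - k and k agree modulo [N]; both are below [N] = 2q + 1, so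
       this forces k = q. *)
    case: eqP => [/(canRL (mulfVK _))|_]; last by rewrite mulr0 mul0rn.
    rewrite mul1r expf_neq0// => /(_ isT) /eqP.
    rewrite (eq_prim_root_expr prim) => /eqP kE.
    exfalso; move/eqP: kneq; apply; apply: val_inj => /=.
    have kb := ltn_ord k; rewrite !modn_small ?/N in kE; lia.
exists (fun j => B^-1 * a j ^+ q.*2), (fun j => b j / a j); split.
  by move=> j; rewrite mulr_ge0 ?invr_ge0 ?(ltW B0)// exprn_even_ge0 ?odd_double.
move=> x y; apply: (mulfI (lt0r_neq0 B0)); rewrite -key mulr_sumr.
apply: eq_bigr => j _; rewrite !mulrA divff ?lt0r_neq0// mul1r -exprMn.
congr (_ ^+ _); have aj0 : a j != 0 by apply/eqP => /aE.
by field.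
Qed.

(** * Expansion of products of linear forms into monomials *)

Lemma prod_linear_forms (R : comPzRingType) (n m : nat)
    (a : 'I_n -> 'I_m -> R) (lam : 'I_m -> R) :
  \prod_(j < n) \sum_(i < m) lam i * a j i =
  \sum_(f : {ffun 'I_n -> 'I_m}) (\prod_(j < n) a j (f j)) * \prod_(j < n) lam (f j).
Proof.
rewrite bigA_distr_bigA/=; apply: eq_bigr => f _.
by rewrite big_split/= mulrC.
Qed.

(** The monomial of [f] depends only on the sizes of its fibres, so the coefficients are summed over
    all [f] with equal fibre sizes. Each size is at most [n], hence [inord] truncates nothing. *)
Lemma collect_monomials (R : numDomainType) (n m : nat)
    (C : {ffun 'I_n -> 'I_m} -> R) : (forall f, 0 <= C f) ->
  exists c : {ffun 'I_m -> 'I_n.+1} -> R, (forall e, 0 <= c e) /\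
    forall lam : 'I_m -> R,
      \sum_(f : {ffun 'I_n -> 'I_m}) C f * \prod_(j < n) lam (f j) =
      \sum_(e : {ffun 'I_m -> 'I_n.+1}) c e * \prod_(i < m) lam i ^+ e i.
Proof.
move=> C0.
pose cnt (f : {ffun 'I_n -> 'I_m}) : {ffun 'I_m -> 'I_n.+1} :=
  [ffun i => inord #|[pred j | f j == i]|].
exists (fun e => \sum_(f | cnt f == e) C f); split.
  by move=> e; exact: sumr_ge0.
move=> lam; rewrite (partition_big cnt xpredT)//=.
apply: eq_bigr => e _; rewrite mulr_suml; apply: eq_bigr => f /eqP <-.
congr (_ * _); rewrite (partition_big f xpredT)//=.
apply: eq_bigr => i _; rewrite ffunE inordK; last first.
  by rewrite ltnS (leq_trans (max_card _))// card_ord.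
by under eq_bigr => j /eqP -> do []; rewrite prodr_const.
Qed.

(** * Invariance of Lebesgue measure under translations and shears *)

Lemma lebesgue_measure_shift (R : realType) (c : R) (A : set (measurableTypeR R)) :
  measurable A ->
  pushforward (@lebesgue_measure R) (fun x : measurableTypeR R => (x + c)%R : measurableTypeR R) A =
  lebesgue_measure A.
Proof.
move=> mA; have mc : measurable_fun setT (fun x : measurableTypeR R => (x + c)%R : measurableTypeR R).
  exact: measurable_funD.
pose m := pushforward (@lebesgue_measure R) (fun x : measurableTypeR R => (x + c)%R : measurableTypeR R).
apply/esym/lebesgue_measure_unique => //= _ [[a b]] _ <-.
rewrite /pushforward.
rewrite (_ : _ @^-1` _ = `]a - c, b - c]%classic); last first.
  by apply/seteqP; split=> x /=; rewrite !in_itv/= ltrBlDr lerBrDr.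
rewrite !lebesgue_measure_itv/= !lte_fin ltrD2r.
by case: ifP => // _; rewrite -!EFinB; congr EFin; ring.
Qed.

Lemma ge0_integral_shift (R : realType) (c : R) (f : R -> \bar R) :
  measurable_fun setT f -> (forall x, 0 <= f x)%E ->
  (\int[@lebesgue_measure R]_x f (x + c)%R = \int[@lebesgue_measure R]_x f x)%E.
Proof.
move=> mf f0.
have mc : measurable_fun setT (fun x : measurableTypeR R => (x + c)%R : measurableTypeR R).
  exact: measurable_funD.
have -> : (\int[@lebesgue_measure R]_x f x =
    \int[pushforward (@lebesgue_measure R) (fun x : measurableTypeR R => (x + c)%R : measurableTypeR R)]_x f x)%E.
  by apply: eq_measure_integral => //= A mA _; exact/esym/lebesgue_measure_shift.
by rewrite ge0_integral_pushforward//= preimage_setT.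
Qed.

Definition shear (R : realType) (c : R) (s : R * R) : R * R := (s.1 + c * s.2, s.2).

Lemma measurable_shear (R : realType) (c : R) :
  measurable_fun setT (shear c).
Proof.
apply/measurable_fun_pairP; split => /=.
  rewrite (_ : _ \o _ = fun s : R * R => s.1 + c * s.2)//.
  apply: measurable_funD; first exact: measurable_fst.
  by apply: measurable_funM => //; exact: measurable_snd.
by rewrite (_ : _ \o _ = snd)//.
Qed.

(** On the horizontal line at height [y] the shear is the translation by [c * y]; Tonelli with [y]
    as outer variable reduces to the one-dimensional case. *)
Lemma ge0_integral_shear (R : realType) (c : R) (f : R * R -> \bar R) :
  measurable_fun setT f -> (forall x, 0 <= f x)%E ->
  (\int[@lebesgue2 R]_s f (shear c s) = \int[@lebesgue2 R]_s f s)%E.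
Proof.
move=> mf f0.
transitivity (\int[@lebesgue_measure R]_y
    fubini_G (@lebesgue_measure R) (f \o shear c) y)%E.
  apply: fubini_tonelli2 => //.
  by apply: measurableT_comp => //; exact: measurable_shear.
transitivity (\int[@lebesgue_measure R]_y fubini_G (@lebesgue_measure R) f y)%E; last first.
  by apply/esym/fubini_tonelli2.
apply: eq_integral => y _; rewrite /fubini_G /=.
rewrite -(@ge0_integral_shift _ (c * y) (fun x => f (x, y)))//.
exact: measurableT_comp.
Qed.

(** * Measurability and compactness of planar sets *)

Lemma open_measurable2 (R : realType) (U : set (R * R)) : open U -> measurable U.
Proof.
move=> oU.
(* The sigma-algebra is the product one, so an open set is exhibited as the countable union of the
   rational boxes it contains; the other indices contribute [set0]. *)
pose box (p : (rat * rat) * (rat * rat)) : set (R * R) :=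
  `]ratr p.1.1, ratr p.1.2[%classic `*` `]ratr p.2.1, ratr p.2.2[%classic.
rewrite (_ : U = \bigcup_p (if `[< box p `<=` U >] then box p else set0)); last first.
  apply/seteqP; split => [[x y] Uxy|s [p _]]; last first.
    by case: asboolP => // + /= sp => /(_ _ sp).
  have /= := oU; rewrite openE => /(_ _ Uxy)[[A B] /= [Ax By] ABU].
  have rat_box (z : R) (V : set R) : nbhs z V ->
      exists p : rat * rat, (`]ratr p.1, ratr p.2[%classic z) /\ `]ratr p.1, ratr p.2[ `<=` V.
    move=> /nbhs_ballP[e /= e0 eV].
    have /rat_in_itvoo[p pz] : z - e < z by rewrite ltrBlDr ltrDl.
    have /rat_in_itvoo[r rz] : z < z + e by rewrite ltrDl.
    move: pz rz; rewrite !in_itv/= => /andP[p1 p2] /andP[r1 r2].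
    exists (p, r); split; first by rewrite /= in_itv/= p2 r1.
    move=> t /=; rewrite in_itv/= => /andP[t1 t2]; apply: eV.
    by rewrite /ball/= ltr_distlC; lra.
  have [p [px pA]] := rat_box _ _ Ax; have [r [ry rB]] := rat_box _ _ By.
  exists (p, r) => //; case: asboolP => [_|[]]; first by split.
  by move=> s [/pA s1 /rB s2]; exact: ABU.
apply: countable_bigcupT_measurable => // p.
by case: asboolP => // _; apply: measurableX; exact: measurable_itv.
Qed.

Lemma compact_measurable2 (R : realType) (K : set (R * R)) : compact K -> measurable K.
Proof.
move=> cK; rewrite -(setCK K); apply: measurableC; apply: open_measurable2.
by apply: closed_openC; apply: compact_closed => //; exact: Rhausdorff.
Qed.

(** The combination is the image of a product of compact sets, compact by Tychonoff, under a
    continuous map. *)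
Lemma compact_minkowski_comb (R : realType) (m : nat) (lam : 'I_m -> R)
    (K : 'I_m -> set (R * R)) :
  (forall i, compact (K i)) -> compact (minkowski_comb lam K).
Proof.
move=> cK; pose T (i : 'I_m) : topologicalType := (R * R)%type.
pose F (x : prod_topology T) : R * R :=
  (\sum_(i < m) (lam i * (x i).1), \sum_(i < m) (lam i * (x i).2)).
rewrite (_ : minkowski_comb lam K = F @` [set x | forall i, K i (x i)]); last first.
  by apply/seteqP; split => [_ [x [Kx ->]]|_ [x Kx <-]]; exists x.
apply: (@continuous_compact (prod_topology T) (R * R)%type F); last exact: (@tychonoff _ T).
apply: continuous_subspaceT => x.
have addc : continuous (fun u : R * R => u.1 + u.2) by exact: add_continuous.
have fstc a : continuous (fun z : R * R => a * z.1).
  by move=> z; apply: cvgM; [exact: cvg_cst|exact: cvg_fst].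
have sndc a : continuous (fun z : R * R => a * z.2).
  by move=> z; apply: cvgM; [exact: cvg_cst|exact: cvg_snd].
have prj i : continuous (fun x : prod_topology T => x i : T i) by exact: proj_continuous.
have c1 : continuous (fun x : prod_topology T => \sum_(i < m) lam i * (x i).1).
  apply: (continuous_big addc) => i _ y.
  exact: (@continuous_comp (prod_topology T) (R * R)%type R (fun x => x i) (fun z : R * R => lam i * z.1) y (prj i y) (fstc _ _)).
have c2 : continuous (fun x : prod_topology T => \sum_(i < m) lam i * (x i).2).
  apply: (continuous_big addc) => i _ y.
  exact: (@continuous_comp (prod_topology T) (R * R)%type R (fun x => x i) (fun z : R * R => lam i * z.2) y (prj i y) (sndc _ _)).
exact: (cvg_pair (c1 x) (c2 x)).
Qed.

(** * Integrals over intervals and primitives with monotone slope *)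

Section interval_integrals.
Variable R : realType.
Local Notation mu := (@lebesgue_measure R).
Implicit Types (f g F : R -> R) (a b c K : R).

Lemma bounded_integrable_itv f K a b : measurable_fun setT f ->
  (forall x, `|f x| <= K) -> mu.-integrable `[a, b] (EFin \o f).
Proof.
move=> mf fK; apply: measurable_bounded_integrable => //.
- rewrite /= lebesgue_measure_itv/=.
  by case: ifP => _ //; rewrite -EFinB ltry.
- exact: measurable_funTS.
- exists K; split; first exact: num_real.
  by move=> M KM x _ /=; rewrite (le_trans (fK x))// ltW.
Qed.

Lemma Rintegral_itv_cat f K a b c : measurable_fun setT f ->
  (forall x, `|f x| <= K) -> a <= b -> b <= c ->
  \int[mu]_(x in `[a, c]) f x = \int[mu]_(x in `[a, b]) f x + \int[mu]_(x in `[b, c]) f x.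
Proof.
move=> mf fK ab bc; have fi u v := bounded_integrable_itv u v mf fK.
have := @Rintegral_itvB R f (BLeft a) (BRight c) b (fi a c).
rewrite !bnd_simp => /(_ ab bc) /eqP; rewrite subr_eq addrC => /eqP ->.
congr (_ + _); apply: Rintegral_itv_obnd_cbnd.
by apply: integrableS (fi b c) => //; exact: subset_itv_oc_cc.
Qed.

Lemma eq_Rintegral_itv f g a b : measurable_fun setT f -> measurable_fun setT g ->
  (forall x, a < x -> x < b -> f x = g x) ->
  \int[mu]_(x in `[a, b]) f x = \int[mu]_(x in `[a, b]) g x.
Proof.
move=> mf mg fg; rewrite /Rintegral; congr fine.
have oo (h : R -> R) : measurable_fun setT h ->
    (\int[mu]_(x in `[a, b]) (h x)%:E = \int[mu]_(x in `]a, b[) (h x)%:E)%E.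
  by move=> mh; apply: integral_itv_bndoo; exact/measurable_EFinP/measurable_funTS.
rewrite !oo//.
apply: eq_integral => x; rewrite inE/= in_itv/= => /andP[ax xb].
by rewrite fg.
Qed.

Lemma Rintegral_itv_cst a b K : a <= b -> \int[mu]_(_ in `[a, b]) K = K * (b - a).
Proof.
move=> ab; rewrite Rintegral_cst//= lebesgue_measure_itv/= lte_fin.
by case: ltgtP ab => // -> _; rewrite subrr.
Qed.

(* The two sandwiched quantities are additive over subintervals, so bisecting
   [k] times divides the total error by [2 ^ k]. *)
Lemma Rintegral_slope_bounds F g K : (forall x, `|g x| <= K) ->
  (forall a b, a <= b -> g b * (b - a) <= F b - F a <= g a * (b - a)) ->
  forall a b, a <= b -> \int[mu]_(x in `[a, b]) g x = F b - F a.
Proof.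
move=> gK Fg.
have gni a b : a <= b -> g b <= g a.
  rewrite le_eqVlt => /predU1P[->//|ab].
  have /andP[+ +] := Fg _ _ (ltW ab) => /le_trans/[apply].
  by rewrite ler_pM2r// subr_gt0.
have mg : measurable_fun setT g by apply: nonincreasing_measurable => // x y; exact: gni.
have gi a b := bounded_integrable_itv a b mg gK.
pose D a b := F b - F a - \int[mu]_(x in `[a, b]) g x.
have D1 a b : a <= b -> `|D a b| <= (g a - g b) * (b - a).
  move=> ab; have /andP[F1 F2] := Fg _ _ ab.
  have ci c : mu.-integrable `[a, b] (EFin \o cst c).
    by apply: (@bounded_integrable_itv _ `|c|).
  have I1 : g b * (b - a) <= \int[mu]_(x in `[a, b]) g x.
    rewrite -Rintegral_itv_cst//; apply: le_Rintegral => //; try exact: ci; move=> x /=.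
    by rewrite in_itv/= => /andP[_ ?]; exact: gni.
  have I2 : \int[mu]_(x in `[a, b]) g x <= g a * (b - a).
    rewrite -Rintegral_itv_cst//; apply: le_Rintegral => //; try exact: ci; move=> x /=.
    by rewrite in_itv/= => /andP[? _]; exact: gni.
  rewrite /D; move: (\int[mu]_(x in `[a, b]) g x) I1 I2 => I I1 I2.
  by rewrite ler_norml; apply/andP; split; lra.
(* In a bisection the two drops of [g] add up to [g a - g b] while both lengths are halved, so the
   sum of the two error bounds is half of the old one. *)
have Dk k : forall a b, a <= b -> `|D a b| <= (g a - g b) * (b - a) / 2 ^+ k.
  elim: k => [|k IH] a b ab; first by rewrite expr0 divr1 D1.
  pose c := (a + b) / 2.
  have ac : a <= c by rewrite /c; lra.
  have cb : c <= b by rewrite /c; lra.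
  have -> : D a b = D a c + D c b.
    by rewrite /D (Rintegral_itv_cat mg gK ac cb); ring.
  apply: (le_trans (ler_normD _ _)); apply: (le_trans (lerD (IH _ _ ac) (IH _ _ cb))).
  rewrite -mulrDl exprS invfM mulrA ler_pM2r ?invr_gt0 ?exprn_gt0//.
  have -> : c - a = (b - a) / 2 by rewrite /c; field.
  have -> : b - c = (b - a) / 2 by rewrite /c; field.
  by rewrite le_eqVlt; apply/orP; left; apply/eqP; field.
move=> a b ab; apply/eqP; rewrite eq_sym -subr_eq0 -/(D a b) -normr_eq0.
apply/eqP/le_anti; rewrite normr_ge0 andbT leNgt; apply/negP => D0.
set C := (g a - g b) * (b - a) in Dk.
have := truncnS_gt (C / `|D a b|); set k := (Num.truncn _).+1 => Ck.
have := Dk k _ _ ab; rewrite -/C leNgt => /negP; apply.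
rewrite ltr_pdivrMr ?exprn_gt0// mulrC -ltr_pdivrMr//.
by apply: (lt_le_trans Ck); rewrite -natrX ler_nat ltnW// ltn_expl.
Qed.

End interval_integrals.

(** * One-dimensional moments *)

Section moments.
Variable R : realType.
Local Notation mu := (@lebesgue_measure R).

Lemma Rintegral_exprn n (a b : R) : a <= b ->
  \int[mu]_(x in `[a, b]) x ^+ n = (b ^+ n.+1 - a ^+ n.+1) / n.+1%:R.
Proof.
rewrite le_eqVlt => /predU1P[->|ab]; first by rewrite set_itv1 Rintegral_set1 subrr mul0r.
have Fc : continuous (fun x : R => x ^+ n.+1 / n.+1%:R).
  by move=> x; apply: cvgM; [exact: exprn_continuous|exact: cvg_cst].
rewrite /Rintegral (@continuous_FTC2 _ _ (fun x : R => x ^+ n.+1 / n.+1%:R))//.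
- by rewrite -EFinB /= mulrBl.
- by apply: continuous_in_subspaceT => x _; exact: exprn_continuous.
- split.
  + by move=> x _; apply: derivableM => //; exact: exprn_derivable.
  + by apply: cvg_at_right_filter; exact: Fc.
  + by apply: cvg_at_left_filter; exact: Fc.
- move=> x _; rewrite derive1Mr; last exact: exprn_derivable.
  by rewrite derive1E exp_derive /= scaler1 mulrAC divff// mul1r.
Qed.

Lemma Rintegral_binomial_form n (c d a b : R) : a <= b ->
  \int[mu]_(x in `[a, b]) (c * x ^+ n + d * x ^+ n.+1) =
  c * ((b ^+ n.+1 - a ^+ n.+1) / n.+1%:R) + d * ((b ^+ n.+2 - a ^+ n.+2) / n.+2%:R).
Proof.
move=> ab.
have pi k e : mu.-integrable `[a, b] (EFin \o (fun x => e * x ^+ k)).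
  apply: continuous_compact_integrable; first exact: segment_compact.
  apply: continuous_in_subspaceT => x _.
  by apply: cvgM; [exact: cvg_cst|exact: exprn_continuous].
have p1 k : mu.-integrable `[a, b] (EFin \o (fun x => x ^+ k)).
  apply: continuous_compact_integrable; first exact: segment_compact.
  by apply: continuous_in_subspaceT => x _; exact: exprn_continuous.
rewrite RintegralD//; try exact: pi.
by rewrite !RintegralZl//; try exact: p1; rewrite !Rintegral_exprn.
Qed.

(** The factor after [t ^+ q.*2] vanishes outside [[- A, A]]; the breakpoints [- xi] and [xi] cut it
    into [A + t], [A - xi] and [A - t], so each piece is a two-term polynomial. *)
Lemma integral_moment_kernel (q : nat) (A xi : R) : 0 <= xi -> xi <= A ->
  (\int[mu]_t (t ^+ q.*2 * Num.max 0 (A - Num.max `|t| xi))%:E =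
   (2 / (q.*2.+1%:R * q.*2.+2%:R) * (A ^+ q.*2.+2 - xi ^+ q.*2.+2))%:E)%E.
Proof.
move=> xi0 xiA; have A0 : 0 <= A by exact: le_trans xiA.
pose f t : R := t ^+ q.*2 * Num.max 0 (A - Num.max `|t| xi).
have mf : measurable_fun setT f.
  apply: measurable_funM; first exact: measurable_funX.
  by apply: measurable_maxr => //; apply: measurable_funB => //; exact: measurable_maxr.
have f0 t : t \notin `[- A, A] -> f t = 0.
  rewrite in_itv/= -ler_norml -ltNge => At; rewrite /f.
  suff /max_idPl -> : A - Num.max `|t| xi <= 0 by rewrite mulr0.
  by rewrite subr_le0 le_max (ltW At).
have fb t : `|f t| <= A ^+ q.*2 * A.
  have [|/f0 ->] := boolP (t \in `[- A, A]); last by rewrite normr0 mulr_ge0 ?exprn_ge0.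
  rewrite in_itv/= -ler_norml => tA; rewrite /f normrM normrX ler_pM ?exprn_ge0//.
    by rewrite lerXn2r.
  rewrite ger0_norm ?le_max ?lexx// ge_max A0/= gerBl.
  by rewrite le_max normr_ge0.
have fE : (\int[mu]_t (f t)%:E = (\int[mu]_(t in `[- A, A]) f t)%:E)%E.
  rewrite /Rintegral fineK; last first.
    by apply: integrable_fin_num => //; exact: bounded_integrable_itv fb.
  rewrite [RHS]integral_mkcond; apply: eq_integral => t _; rewrite patchE.
  by case: ifPn => //; rewrite mem_setE => /f0 ->.
rewrite [LHS]fE; congr EFin.
have mp c d n : measurable_fun setT (fun x : R => c * x ^+ n + d * x ^+ n.+1).
  by apply: measurable_funD; apply: measurable_funM => //; exact: measurable_funX.
have NxiA : - A <= - xi by rewrite lerN2.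
have Nxi : - xi <= xi by rewrite (le_trans _ xi0)// oppr_le0.
rewrite (Rintegral_itv_cat mf fb NxiA); last exact: le_trans xiA.
rewrite (Rintegral_itv_cat mf fb Nxi xiA).
have -> : \int[mu]_(t in `[- A, - xi]) f t =
    \int[mu]_(t in `[- A, - xi]) (A * t ^+ q.*2 + 1 * t ^+ q.*2.+1).
  apply: eq_Rintegral_itv => // t At txi; rewrite /f.
  have t0 : t <= 0 by rewrite (le_trans (ltW txi))// oppr_le0.
  have /max_idPl -> : xi <= `|t| by rewrite ler0_norm// lerNr ltW.
  rewrite ler0_norm// opprK.
  have /max_idPr -> : 0 <= A + t by rewrite -lerBlDl sub0r ltW.
  by rewrite exprS; ring.
have -> : \int[mu]_(t in `[- xi, xi]) f t =
    \int[mu]_(t in `[- xi, xi]) ((A - xi) * t ^+ q.*2 + 0 * t ^+ q.*2.+1).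
  apply: eq_Rintegral_itv => // t xit txi; rewrite /f.
  have /max_idPr -> : `|t| <= xi by rewrite ler_norml !ltW.
  have /max_idPr -> : 0 <= A - xi by rewrite subr_ge0.
  by ring.
have -> : \int[mu]_(t in `[xi, A]) f t =
    \int[mu]_(t in `[xi, A]) (A * t ^+ q.*2 + (- 1) * t ^+ q.*2.+1).
  apply: eq_Rintegral_itv => // t xit tA; rewrite /f.
  have t0 : 0 <= t by rewrite (le_trans xi0)// ltW.
  have /max_idPl -> : xi <= `|t| by rewrite ger0_norm// ltW.
  rewrite ger0_norm//.
  have /max_idPr -> : 0 <= A - t by rewrite subr_ge0 ltW.
  by rewrite exprS; ring.
rewrite !Rintegral_binomial_form//.
have odN (x : R) : (- x) ^+ q.*2.+1 = - x ^+ q.*2.+1.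
  by rewrite exprNn -signr_odd/= odd_double expr1 mulN1r.
have evN (x : R) : (- x) ^+ q.*2.+2 = x ^+ q.*2.+2.
  by rewrite exprNn -signr_odd/= odd_double expr0 mul1r.
rewrite !odN !evN ![_ ^+ q.*2.+2]exprS.
have -> : q.*2.+2%:R = q.*2.+1%:R + 1 :> R by rewrite -addn1 natrD.
have q1 : 0 < q.*2.+1%:R :> R by rewrite ltr0n.
move: (q.*2.+1%:R) q1 (A ^+ _) (xi ^+ _) => n n0 a x.
by field; rewrite !lt0r_neq0//; lra.
Qed.

End moments.

(** * Vertical sections of a symmetric convex set in terms of its support function *)

Section support_data.
Variables (R : realType) (L : set (R * R)) (A V : R) (xs ys : R -> R).
Local Notation mu := (@lebesgue_measure R).
Let h s := ys s - s * xs s.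
Hypothesis convL : convex_set2 L.
Hypothesis symL : forall p, L p -> L (vopp p).
Hypothesis mL : measurable L.
Hypothesis supp_mem : forall s, L (xs s, ys s).
Hypothesis supp_max : forall s p, L p -> p.2 - s * p.1 <= h s.
Hypothesis fst_le : forall p, L p -> `|p.1| <= A.
Hypothesis fst_max : exists y, L (A, y).
(** For large n, [h (- n)] is about A n plus the top ordinate at abscissa [A], and by symmetry [h n]
    is about A n minus the bottom ordinate there; the limit is thus the edge length. As a limit of
    expressions linear in the support data, it is visibly Minkowski linear. *)
Hypothesis cvgV : (fun n : nat => h n%:R + h (- n%:R) - 2 * A * n%:R) @ \oo --> V.

Lemma abscissa_le s : `|xs s| <= A.
Proof. exact: (fst_le (supp_mem s)). Qed.

Lemma ordinate_le p : L p -> `|p.2| <= h 0.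
Proof.
move=> Lp; have := supp_max 0 Lp; have := supp_max 0 (symL Lp).
by rewrite /= ler_norml; lra.
Qed.

(** Each of the two maximizing points is tested against the slope of the other. The bounds say that
    [- xs] is a subgradient of the convex function [h]. *)
Lemma support_slope s t : xs t * (t - s) <= h s - h t <= xs s * (t - s).
Proof.
have := supp_max s (supp_mem t); have := supp_max t (supp_mem s).
by rewrite /h /=; lra.
Qed.

Lemma abscissa_nonincreasing s t : s <= t -> xs t <= xs s.
Proof.
rewrite le_eqVlt => /predU1P[->//|st].
have /andP[+ +] := support_slope s t => /le_trans/[apply].
by rewrite ler_pM2r// subr_gt0.
Qed.

Lemma measurable_abscissa : measurable_fun setT xs.
Proof. by apply: nonincreasing_measurable => // s t; exact: abscissa_nonincreasing. Qed.

Lemma abscissa_gt t : t < A -> exists s, t < xs s.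
Proof.
move=> tA; have [y0 Ly0] := fst_max.
have At : A - t != 0 by rewrite subr_eq0 gt_eqF.
(* Ordinates in [L] differ by at most [2 * h 0]. At this slope, moving from abscissa at most [t] to
   abscissa [A] gains at least [2 * h 0 + 1], so a maximizer cannot lie at or left of [t]. *)
pose s := - (2 * h 0 + 1) / (A - t); exists s; rewrite ltNge; apply/negP => xst.
have := ordinate_le Ly0; rewrite /= ler_norml => /andP[y1 y2].
have := ordinate_le (supp_mem s); rewrite /= ler_norml => /andP[y3 y4].
have s0 : s <= 0 by rewrite /s mulNr oppr_le0 divr_ge0//; lra.
have e : s * (A - t) = - (2 * h 0 + 1) by rewrite /s divfK.
have : s * (t - xs s) <= 0 by rewrite mulr_le0_ge0// subr_ge0.
have := supp_max s Ly0; rewrite /= /h.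
by move: (h 0) e y1 y2 y3 y4 => H; lra.
Qed.

Lemma abscissa_lt t : - A < t -> exists s, xs s < t.
Proof.
move=> tA; have [y0 /symL Ly0] := fst_max.
have At : A + t != 0 by rewrite addr_eq0 gt_eqF// ltrNl.
pose s := (2 * h 0 + 1) / (A + t); exists s; rewrite ltNge; apply/negP => xst.
have := ordinate_le Ly0; rewrite /= ler_norml => /andP[y1 y2].
have := ordinate_le (supp_mem s); rewrite /= ler_norml => /andP[y3 y4].
have s0 : 0 <= s by rewrite /s divr_ge0//; lra.
have e : s * (A + t) = 2 * h 0 + 1 by rewrite /s divfK.
have : 0 <= s * (xs s - t) by rewrite mulr_ge0// subr_ge0.
have := supp_max s Ly0; rewrite /= /h.
by move: (h 0) e y1 y2 y3 y4 => H; lra.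
Qed.

(* The slope of the supporting line of [L] above abscissa [t]. *)
Let sg t := sup [set s | t <= xs s].
(** The height at abscissa [t] of the supporting line of slope [sg t]; for [|t| < A] it turns out to
    be the supremum of the section there. *)
Let U t := h (sg t) + t * sg t.

Let has_sup_sg t : `|t| < A -> has_sup [set s | t <= xs s].
Proof.
rewrite ltr_norml => /andP[At tA]; split.
  by have [s /ltW ?] := abscissa_gt tA; exists s.
have [s1 xs1] := abscissa_lt At; exists s1 => s /= txs.
rewrite leNgt; apply/negP => /ltW/abscissa_nonincreasing xss1.
by have := lt_le_trans xs1 (le_trans txs xss1); rewrite ltxx.
Qed.

Lemma abscissa_ge_left t s : `|t| < A -> s < sg t -> t <= xs s.
Proof.
move=> /has_sup_sg[t0 _] /(sup_gt t0)[r /= tr /ltW/abscissa_nonincreasing].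
exact: le_trans.
Qed.

Lemma abscissa_le_right t s : `|t| < A -> sg t < s -> xs s <= t.
Proof.
move=> /has_sup_sg[_ tb] sgs; rewrite leNgt; apply/negP => /ltW txs.
by have := ub_le_sup tb txs; rewrite leNgt sgs.
Qed.

Lemma sg_nonincreasing t r : `|t| < A -> `|r| < A -> r <= t -> sg t <= sg r.
Proof.
move=> tA rA rt; rewrite leNgt; apply/negP.
move=> /(sup_gt (has_sup_sg tA).1)[s /= ts]; rewrite ltNge => /negP; apply.
by apply: (ub_le_sup (has_sup_sg rA).2) => /=; exact: le_trans ts.
Qed.

Lemma section_ub t y : L (t, y) -> y <= U t.
Proof. by move=> /(supp_max (sg t)); rewrite /U /= lerBlDr mulrC. Qed.

(** Slopes slightly below and above [sg t] have maximizers whose abscissas straddle [t] and which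
    lie less than [e] below the supporting line of slope [sg t]. Their convex combination at
    abscissa [t] has the same property. *)
Lemma section_lub t e : `|t| < A -> 0 < e -> exists2 y, L (t, y) & U t - e < y.
Proof.
move=> tA e0; have A0 : 0 < A by exact: le_lt_trans tA.
pose d := e / (2 * A + 1).
have d0 : 0 < d by rewrite /d divr_gt0//; lra.
have de : d * (2 * A) < e.
  by rewrite /d mulrAC ltr_pdivrMr ?ltr_pM2l//; lra.
pose s1 := sg t - d; pose s2 := sg t + d.
have x1 : t <= xs s1 by apply: abscissa_ge_left => //; rewrite /s1; lra.
have x2 : xs s2 <= t by apply: abscissa_le_right => //; rewrite /s2; lra.
have := abscissa_le s1; have := abscissa_le s2; have := abscissa_le (sg t).
rewrite !ler_norml => /andP[a1 a2] /andP[a3 a4] /andP[a5 a6].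
have low s r : s = sg t + r -> `|r| = d -> h (sg t) - e < ys s - sg t * xs s.
  move=> sE rd; have /andP[_] := support_slope (sg t) s.
  have -> : ys s - sg t * xs s = h s + r * xs s by rewrite /h sE; ring.
  have -> : s - sg t = r by rewrite sE; ring.
  have : `|r * (xs (sg t) - xs s)| <= d * (2 * A).
    rewrite normrM rd ler_pM2l//.
    have := abscissa_le s; rewrite !ler_norml; lra.
  by rewrite ler_norml; lra.
have nd : `|d| = d by rewrite gtr0_norm.
have l1 := low s1 (- d) erefl (etrans (normrN d) nd); have l2 := low s2 d erefl nd.
(* If the two abscissas coincide, the weight [th] below would divide by 0, but then both are
   squeezed to [t] and one point suffices. *)
have [x12|x12] := eqVneq (xs s1) (xs s2).
  have xt : xs s1 = t by apply/le_anti; rewrite x1 x12 x2.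
  exists (ys s1); first by rewrite -xt; exact: supp_mem.
  by move: l1; rewrite xt /U; lra.
have x21 : 0 < xs s1 - xs s2 by rewrite subr_gt0 lt_neqAle eq_sym x12 (le_trans x2).
pose th := (t - xs s2) / (xs s1 - xs s2).
have th0 : 0 <= th by apply: divr_ge0; [rewrite subr_ge0|exact: ltW].
have th1 : th <= 1 by rewrite ler_pdivrMr// mul1r lerB.
have thE : th * xs s1 + (1 - th) * xs s2 = t.
  by rewrite /th; field; rewrite lt0r_neq0.
exists (th * ys s1 + (1 - th) * ys s2).
  by have := convL (supp_mem s1) (supp_mem s2) th0 th1; rewrite /vadd /vscale/= thE.
pose a := ys s1 - sg t * xs s1 - (h (sg t) - e).
pose b := ys s2 - sg t * xs s2 - (h (sg t) - e).
have a0 : 0 < a by rewrite subr_gt0.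
have b0 : 0 < b by rewrite subr_gt0.
have pos : 0 < th * a + (1 - th) * b.
  have [->|th_neq0] := eqVneq th 0; first by lra.
  apply: ltr_pwDl; first by rewrite mulr_gt0// lt_neqAle eq_sym th_neq0.
  by rewrite mulr_ge0 ?subr_ge0// ltW.
rewrite -subr_gt0 /U; apply: (lt_le_trans pos).
by rewrite le_eqVlt -{2}thE /a /b; apply/orP; left; apply/eqP; ring.
Qed.

Lemma section_convex t y1 y2 y :
  L (t, y1) -> L (t, y2) -> y1 < y -> y < y2 -> L (t, y).
Proof.
move=> L1 L2 y1y yy2; have y12 : 0 < y2 - y1 by lra.
pose th := (y2 - y) / (y2 - y1).
have th0 : 0 <= th by apply: divr_ge0; [rewrite subr_ge0|]; exact: ltW.
have th1 : th <= 1 by rewrite ler_pdivrMr// mul1r lerB// ltW.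
have := convL L1 L2 th0 th1; rewrite /vadd /vscale/=.
have -> : th * t + (1 - th) * t = t by ring.
suff -> : th * y1 + (1 - th) * y2 = y by [].
by rewrite /th; field; rewrite lt0r_neq0.
Qed.

(** By symmetry the bottom of the section is [- U (- t)]. The section lies between the open and the
    closed interval with these ends, which have equal length, so whether the ends belong to [L] is
    irrelevant. *)
Lemma section_measure t : `|t| < A -> mu (xsection L t) = (U t + U (- t))%:E.
Proof.
move=> tA; have tA' : `|- t| < A by rewrite normrN.
have mS : measurable (xsection L t) by exact: measurable_xsection.
have low y : L (t, y) -> - U (- t) <= y.
  by move=> /symL; rewrite /vopp/= => /section_ub; rewrite lerNl.
have UU : - U (- t) <= U t.
  have [y Ly _] := section_lub tA ltr01.
  exact: le_trans (low _ Ly) (section_ub Ly).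
have sub1 : xsection L t `<=` `[- U (- t), U t].
  move=> y /=; rewrite /xsection/= inE => Ly.
  by rewrite in_itv/= low// section_ub.
have sub2 : `]- U (- t), U t[ `<=` xsection L t.
  move=> y /=; rewrite in_itv/= => /andP[y1 y2]; rewrite /xsection/= inE.
  have e2 : 0 < U t - y by rewrite subr_gt0.
  have [z2 Lz2] := section_lub tA e2; rewrite subKr => yz2.
  have e1 : 0 < U (- t) + y by rewrite -ltrBlDl sub0r.
  have [z1 /symL Lz1] := section_lub tA' e1; rewrite opprD addNKr => yz1.
  rewrite /vopp/= opprK in Lz1.
  by apply: section_convex Lz1 Lz2 _ yz2; rewrite ltrNl.
apply/eqP; rewrite eq_le; apply/andP; split.
  have /(le_measure mu) := sub1; rewrite ?inE => /(_ mS (measurable_itv _)).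
  rewrite /= lebesgue_measure_itv/= lte_fin; case: ltgtP UU => // [_ _|<- _].
    by rewrite -EFinB opprK.
  by rewrite addNr.
have /(le_measure mu) := sub2; rewrite ?inE => /(_ (measurable_itv _) mS).
rewrite /= lebesgue_measure_itv/= lte_fin; case: ltgtP UU => // [_ _|<- _].
  by rewrite -EFinB opprK.
by rewrite addNr.
Qed.

(** Subgradient bounds suffice to integrate a convex function's slope: [h] may have kinks, at which
    [xs] jumps. *)
Lemma Rintegral_abscissa a b : a <= b -> \int[mu]_(s in `[a, b]) xs s = h a - h b.
Proof.
move=> ab; rewrite (@Rintegral_slope_bounds _ (fun s => - h s) xs A)//.
- by rewrite opprK addrC.
- exact: abscissa_le.
- by move=> u v _; rewrite opprK [- h v + _]addrC; exact: support_slope.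
Qed.

Let k (t s : R) : R := A - Num.max t `|xs s|.

Let measurable_k t : measurable_fun setT (k t).
Proof.
apply: measurable_funB => //; apply: measurable_maxr => //.
by apply: measurableT_comp => //; exact: measurable_abscissa.
Qed.

Let k_bound t : 0 <= t -> t < A -> forall s, 0 <= k t s <= A.
Proof.
move=> t0 tA s; rewrite /k subr_ge0 ge_max (ltW tA) abscissa_le/=.
by rewrite gerBl le_max t0.
Qed.

(** The slopes [sg t] and [sg (- t)] are where [xs] crosses [t] and [- t]. Between consecutive cuts
    the kernel is [A - xs s], then [A - t], then [A + xs s], and integrating [xs] produces the
    values of [h] contained in [U t] and [U (- t)]. *)
Lemma Rintegral_kernel t M : 0 <= t -> t < A -> `|sg t| <= M -> `|sg (- t)| <= M ->
  \int[mu]_(s in `[- M, M]) k t s =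
  U t + U (- t) - (h M + h (- M) - 2 * A * M).
Proof.
move=> t0 tA; rewrite !ler_norml => /andP[M1 M2] /andP[M3 M4].
have nt : `|t| < A by rewrite ger0_norm.
have nt' : `|- t| < A by rewrite normrN.
have kK s : `|k t s| <= A.
  by have /andP[k0 kA] := k_bound t0 tA s; rewrite ger0_norm.
have sgt : sg t <= sg (- t) by apply: sg_nonincreasing => //; lra.
have A0 : 0 <= A by rewrite ltW// (le_lt_trans t0).
rewrite (@Rintegral_itv_cat _ _ A _ (sg t))//.
rewrite (@Rintegral_itv_cat _ _ A (sg t) (sg (- t)))//.
have ii a b := bounded_integrable_itv a b measurable_abscissa abscissa_le.
have ci a b : mu.-integrable `[a, b] (EFin \o cst A).
  by apply: (@bounded_integrable_itv _ _ `|A|).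
have -> : \int[mu]_(s in `[- M, sg t]) k t s =
    A * (sg t + M) - (h (- M) - h (sg t)).
  rewrite (@eq_Rintegral_itv _ _ (fun s => A - xs s))//; last 2 first.
    by apply: measurable_funB => //; exact: measurable_abscissa.
    move=> s _ /(abscissa_ge_left nt) ts.
    by rewrite /k ger0_norm ?(le_trans t0)//; move/max_idPr : ts => ->.
  rewrite RintegralB//; try exact: ci; try exact: ii.
  by rewrite Rintegral_itv_cst// opprK Rintegral_abscissa.
have -> : \int[mu]_(s in `[sg t, sg (- t)]) k t s = (A - t) * (sg (- t) - sg t).
  rewrite (@eq_Rintegral_itv _ _ (fun=> A - t))//; first by rewrite Rintegral_itv_cst.
  move=> s /(abscissa_le_right nt) ts /(abscissa_ge_left nt') st.
  by rewrite /k; congr (_ - _); apply/max_idPl; rewrite ler_norml st ts.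
have -> : \int[mu]_(s in `[sg (- t), M]) k t s =
    A * (M - sg (- t)) + (h (sg (- t)) - h M).
  rewrite (@eq_Rintegral_itv _ _ (fun s => A + xs s))//; last 2 first.
    by apply: measurable_funD => //; exact: measurable_abscissa.
    move=> s /(abscissa_le_right nt') ts _.
    have xt : t <= - xs s by rewrite lerNr.
    rewrite /k ler0_norm; last by rewrite -oppr_ge0 (le_trans t0).
    by move/max_idPr : xt => ->; rewrite opprK.
  rewrite RintegralD//; try exact: ci; try exact: ii.
  by rewrite Rintegral_itv_cst// Rintegral_abscissa.
by rewrite /U; ring.
Qed.

(** The window [[- n, n]] eventually contains both crossing slopes. Monotone convergence handles the
    integral and [cvgV] turns the boundary term into [V]. *)
Lemma integral_kernel t : 0 <= t -> t < A ->
  (\int[mu]_s (k t s)%:E = (U t + U (- t) - V)%:E)%E.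
Proof.
move=> t0 tA.
pose F (n : nat) : set R := `[- n%:R, n%:R]%classic.
have FT : \bigcup_n F n = setT.
  rewrite -subTset => s _; exists (Num.truncn `|s|).+1 => //=.
  by rewrite /F/= in_itv/= -ler_norml ltW// truncnS_gt.
have : (\int[mu]_(s in F n) (k t s)%:E)%E @[n --> \oo] -->
    (\int[mu]_s (k t s)%:E)%E.
  rewrite -FT; apply: ge0_nondecreasing_set_cvg_integral.
  - apply/nondecreasing_seqP => n; rewrite subsetEset /F.
    move=> s /=; rewrite !in_itv/= => /andP[s1 s2].
    have nn : n%:R <= n.+1%:R :> R by rewrite ler_nat leqnSn.
    by rewrite (le_trans _ s1) ?lerN2// (le_trans s2).
  - by move=> n; exact: measurable_itv.
  - by move=> n; apply/measurable_EFinP/measurable_funTS; exact: measurable_k.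
  - by move=> n s _; rewrite /= lee_fin; have /andP[] := k_bound t0 tA s.
move=> cvg1; apply: (cvg_unique _ cvg1) => //.
have cvg2 : (fun n : nat => (U t + U (- t) - (h n%:R + h (- n%:R) - 2 * A * n%:R))%:E) @ \oo -->
    (U t + U (- t) - V)%:E.
  by apply: cvg_EFin; [exact: nearW|]; apply: cvgB => //; exact: cvg_cst.
apply: cvg_trans cvg2; apply: near_eq_cvg; near=> n.
rewrite -(@Rintegral_kernel t n%:R)//; last 2 first.
  by near: n; exact: nbhs_infty_ger.
  by near: n; exact: nbhs_infty_ger.
rewrite /Rintegral fineK//; apply: integrable_fin_num => //.
apply: (@bounded_integrable_itv _ _ A) => // s.
by have /andP[k0 kA] := k_bound t0 tA s; rewrite ger0_norm.
Unshelve. all: by end_near. Qed.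

(** Truncation by [Num.max 0] gives one formula on both sides of [A]. The value [|t| = A] is
    excluded because the right-hand side is 0 there, whereas the section may be a whole edge. *)
Lemma section_measure_kernel t : `|t| != A ->
  (mu (xsection L t) = (if `|t| < A then V else 0)%:E +
     \int[mu]_s (Num.max 0 (A - Num.max `|t| `|xs s|))%:E)%E.
Proof.
move=> tneqA; have [tA|At] := ltP `|t| A.
  have -> : (\int[mu]_s (Num.max 0 (A - Num.max `|t| `|xs s|))%:E =
      \int[mu]_s (k `|t| s)%:E)%E.
    apply: eq_integral => s _; congr EFin; apply/max_idPr.
    by have /andP[] := k_bound (normr_ge0 t) tA s.
  rewrite integral_kernel// section_measure// -EFinD; congr EFin.
  have [t0|t0] := leP 0 t; first by rewrite ger0_norm//; ring.
  by rewrite ltr0_norm// opprK; ring.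
have {tneqA}At : A < `|t| by rewrite lt_neqAle eq_sym tneqA.
rewrite (_ : xsection L t = set0) ?measure0; last first.
  rewrite -subset0 => y; rewrite /xsection/= inE => /fst_le /=.
  by rewrite leNgt At.
rewrite add0e integral0_eq// => s _; congr EFin; apply/max_idPl.
by rewrite subr_le0 le_max (ltW At).
Qed.

Lemma abscissa_max_ge0 : 0 <= A.
Proof. exact: le_trans (normr_ge0 _) (abscissa_le 0). Qed.

Lemma edge_length_ge0 : 0 <= V.
Proof.
have [y0 Ly0] := fst_max.
rewrite -(cvg_lim _ cvgV)//; apply: limr_ge; first exact: cvgP cvgV.
apply: nearW => n; have := supp_max n%:R (symL Ly0); have := supp_max (- n%:R) Ly0.
by rewrite /=; lra.
Qed.

Let kmax (t s : R) : R := Num.max 0 (A - Num.max `|t| `|xs s|).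

Let kmax_ge0 t s : 0 <= kmax t s.
Proof. by rewrite le_max lexx. Qed.

Let measurable_moment_kernel n :
  measurable_fun setT (fun z : R * R => (z.1 ^+ n * kmax z.1 z.2)%:E).
Proof.
apply/measurable_EFinP; apply: measurable_funM.
  by apply: measurable_funX; exact: measurable_fst.
apply: measurable_maxr => //; apply: measurable_funB => //.
apply: measurable_maxr.
  by apply: measurableT_comp => //; exact: measurable_fst.
apply: measurableT_comp => //; apply: measurableT_comp; last exact: measurable_snd.
exact: measurable_abscissa.
Qed.

Let integral_edge n :
  (\int[mu]_t (t ^+ n.*2 * (if `|t| < A then V else 0))%:E =
   (2 / n.*2.+1%:R * A ^+ n.*2.+1 * V)%:E)%E.
Proof.
have A0 := abscissa_max_ge0.
have mV : measurable_fun setT (fun t : R => V * t ^+ n.*2).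
  by apply: measurable_funM => //; exact: measurable_funX.
transitivity (\int[mu]_(t in `](- A)%R, A[) (V * t ^+ n.*2)%:E)%E.
  rewrite [RHS]integral_mkcond; apply: eq_integral => t _.
  rewrite patchE mem_setE in_itv/= -ltr_norml; case: ifP => _; last by rewrite mulr0.
  by rewrite mulrC.
rewrite -(@integral_itv_bndoo _ _ _ _ true false); last first.
  exact/measurable_EFinP/measurable_funTS.
have pn : mu.-integrable `[- A, A] (EFin \o (fun t : R => t ^+ n.*2)).
  apply: continuous_compact_integrable; first exact: segment_compact.
  by apply: continuous_in_subspaceT => x _; exact: exprn_continuous.
transitivity (\int[mu]_(t in `[- A, A]) (V * t ^+ n.*2))%:E.
  rewrite /Rintegral fineK//; apply: integrable_fin_num => //.
  exact: (integrableZl _ V pn).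
rewrite RintegralZl// Rintegral_exprn ?ge0_cp//; congr EFin.
rewrite exprNn -signr_odd/= odd_double expr1.
have : n.*2.+1%:R != 0 :> R by rewrite pnatr_eq0.
by rewrite mulN1r opprK; move: (n.*2.+1%:R) => r r0; field.
Qed.

(** Slicing by abscissa leaves the section length weighted by [t ^+ n.*2]. Inserting its kernel
    formula and exchanging [t] with [s] leads to [integral_moment_kernel] at [xi = |xs s|]; the even
    exponent removes the absolute value. The remaining integral is kept in the extended reals. *)
Lemma integral_even_moment n :
  (\int[@lebesgue2 R]_(p in L) (p.1 ^+ n.*2)%:E =
   (2 / n.*2.+1%:R * A ^+ n.*2.+1 * V)%:E +
   (2 / (n.*2.+1%:R * n.*2.+2%:R))%:E *
     \int[mu]_s (A ^+ n.*2.+2 - xs s ^+ n.*2.+2)%:E)%E.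
Proof.
have even_ge0 (t : R) : 0 <= t ^+ n.*2 by rewrite exprn_even_ge0// odd_double.
rewrite integral_mkcond.
set f := ((fun p : R * R => (p.1 ^+ n.*2)%:E) \_ L)%E.
have f0 p : (0 <= f p)%E by rewrite /f patchE; case: ifP => // _; rewrite lee_fin.
have mpow : measurable_fun setT (fun p : R * R => (p.1 ^+ n.*2)%:E).
  by apply/measurable_EFinP/measurable_funX; exact: measurable_fst.
have mf : measurable_fun setT f.
  by apply/(measurable_restrictT _ mL); exact: measurable_funS mpow.
have -> : (\int[@lebesgue2 R]_p f p = \int[mu]_t fubini_F mu f t)%E.
  exact: fubini_tonelli1.
have mk (t : R) : measurable_fun setT (fun s => (kmax t s)%:E).
  by apply/measurable_EFinP/measurable_maxr => //; exact: (measurable_k `|t|).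
have inner t : fubini_F mu f t = ((t ^+ n.*2)%:E * mu (xsection L t))%E.
  rewrite /fubini_F.
  transitivity (\int[mu]_y ((t ^+ n.*2)%:E * (\1_(xsection L t) y)%:E))%E.
    apply: eq_integral => y _; rewrite /f patchE indicE /= mem_xsection.
    by case: ifP => _; rewrite ?mule1 ?mule0.
  rewrite ge0_integralZl//; last 2 first.
  - by apply/measurable_EFinP; exact/measurable_indic/measurable_xsection.
  - by rewrite lee_fin.
  by rewrite integral_indic ?setIT//; exact: measurable_xsection.
pose g1 (t : R) := ((t ^+ n.*2 * (if `|t| < A then V else 0))%:E)%E.
pose g2 (t : R) := (\int[mu]_s (t ^+ n.*2 * kmax t s)%:E)%E.
have g10 t : (0 <= g1 t)%E.
  by rewrite lee_fin mulr_ge0//; case: ifP => // _; exact: edge_length_ge0.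
have k0 (t s : R) : (0 <= (t ^+ n.*2 * kmax t s)%:E)%E by rewrite lee_fin mulr_ge0.
have g20 t : (0 <= g2 t)%E by apply: integral_ge0 => s _.
have mg1 : measurable_fun setT g1.
  apply/measurable_EFinP; apply: measurable_funM; first exact: measurable_funX.
  apply: measurable_fun_ifT => //; apply: measurable_fun_ltr => //.
have mg2 : measurable_fun setT g2.
  apply: (@measurable_fun_fubini_tonelli_F _ _ _ _ _ mu (fun z : R * R => (z.1 ^+ n.*2 * kmax z.1 z.2)%:E)).
    exact: measurable_moment_kernel.
  by move=> z; rewrite lee_fin mulr_ge0.
(* The two abscissas [A] and [- A], where the section formula may fail, form a null set. *)
have rm (u : R -> \bar R) : measurable_fun setT u ->
    (\int[mu]_t u t = \int[mu]_(t in (setT `\ A) `\ (- A)%R) u t)%E.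
  move=> mu_; rewrite !integral_setD1//; try exact: measurable_funTS.
  - exact: measurableD.
  - by apply: measurableD => //; exact: measurableD.
transitivity (\int[mu]_t (g1 t + g2 t))%E.
  rewrite rm; last exact: measurable_fun_fubini_tonelli_F.
  rewrite [RHS]rm; last exact: emeasurable_funD.
  apply: eq_integral => t; rewrite inE => -[[_ /= tA] /= tNA].
  rewrite inner section_measure_kernel; last first.
    by apply/eqP => tE; case: (ger0P t) tE => _ tE; [exact: tA|apply: tNA; rewrite -tE opprK].
  rewrite ge0_muleDr//; last 2 first.
  - by rewrite lee_fin; case: ifP => // _; exact: edge_length_ge0.
  - by apply: integral_ge0 => s _; rewrite lee_fin kmax_ge0.
  congr (_ + _)%E; rewrite -ge0_integralZl//; last by rewrite lee_fin.
    exact: mk.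
  by move=> s _; rewrite lee_fin kmax_ge0.
rewrite ge0_integralD// integral_edge; congr (_ + _)%E.
have -> : (\int[mu]_t g2 t = \int[mu]_s \int[mu]_t (t ^+ n.*2 * kmax t s)%:E)%E.
  apply: (@fubini_tonelli _ _ _ _ _ mu mu
    (fun z : R * R => (z.1 ^+ n.*2 * kmax z.1 z.2)%:E)).
    exact: measurable_moment_kernel.
  by move=> z; rewrite lee_fin mulr_ge0.
transitivity (\int[mu]_s ((2 / (n.*2.+1%:R * n.*2.+2%:R))%:E * (A ^+ n.*2.+2 - xs s ^+ n.*2.+2)%:E))%E.
  apply: eq_integral => s _; rewrite integral_moment_kernel ?abscissa_le//.
  rewrite -EFinM; congr EFin; congr (_ * (_ - _)).
  by rewrite -normrX ger0_norm// exprn_even_ge0//= odd_double.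
rewrite ge0_integralZl ?lee_fin ?divr_ge0//.
  apply/measurable_EFinP; apply: measurable_funB => //.
  by apply: measurable_funX; exact: measurable_abscissa.
move=> s _; rewrite lee_fin subr_ge0.
rewrite -[leLHS]ger0_norm; last by rewrite exprn_even_ge0//= odd_double.
by rewrite normrX lerXn2r ?nnegrE ?abscissa_max_ge0// abscissa_le.
Qed.

End support_data.

(* [(xs s, ys s)] is a point of [L] maximizing [y - s x], [A] is the largest
   abscissa on [L] and [V] the length of the vertical edge at abscissa [A]. *)
Record support_data (R : realType) (L : set (R * R)) (A V : R) (xs ys : R -> R) : Prop :=
  SupportData {
    supp_mem : forall s, L (xs s, ys s);
    supp_max : forall s p, L p -> p.2 - s * p.1 <= ys s - s * xs s;
    fst_le : forall p, L p -> `|p.1| <= A;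
    fst_max : exists y, L (A, y);
    supp_cvg : (fun n : nat => (ys n%:R - n%:R * xs n%:R) +
        (ys (- n%:R) - - n%:R * xs (- n%:R)) - 2 * A * n%:R) @ \oo --> V }.

(** * Existence of support data and its linearity under Minkowski combinations *)

Lemma continuous_linear_form2 (R : realType) (a b : R) :
  continuous (fun p : R * R => a * p.1 + b * p.2).
Proof.
move=> p; apply: (@cvgD _ R^o); apply: cvgM; try exact: cvg_cst.
- exact: cvg_fst.
- exact: cvg_snd.
Qed.

Lemma compact_linear_form_max (R : realType) (L : set (R * R)) (a b : R) :
  compact L -> L !=set0 ->
  exists2 p, L p & forall p', L p' -> a * p'.1 + b * p'.2 <= a * p.1 + b * p.2.
Proof.
move=> cL L0; have [] := @compact_EVT_max _ R (fun p : R * R => a * p.1 + b * p.2) L L0 cL.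
  exact/continuous_subspaceT/continuous_linear_form2.
by move=> p; rewrite inE => Lp pmax; exists p => // p' Lp'; apply: pmax; rewrite inE.
Qed.

Lemma support_data_exists (R : realType) (L : set (R * R)) :
  compact L -> L !=set0 -> (forall p, L p -> L (vopp p)) ->
  exists A V xs ys, support_data L A V xs ys.
Proof.
move=> cL L0 symL.
have [[A y0] Ay Amax] := @compact_linear_form_max _ L 1 0 cL L0.
have leA p : L p -> `|p.1| <= A.
  move=> Lp; have := Amax _ Lp; have := Amax _ (symL _ Lp).
  by rewrite /= ler_norml; lra.
have A0 : 0 <= A by exact: le_trans (normr_ge0 _) (leA _ Ay).
have /choice[p pP] : forall s : R, exists p, L p /\ forall p', L p' -> - s * p'.1 + 1 * p'.2 <= - s * p.1 + 1 * p.2.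
  by move=> s; have [p Lp pm] := @compact_linear_form_max _ L (- s) 1 cL L0; exists p.
pose xs s := (p s).1; pose ys s := (p s).2.
have smem s : L (xs s, ys s) by rewrite -surjective_pairing; exact: (pP s).1.
have smax s p' : L p' -> p'.2 - s * p'.1 <= ys s - s * xs s.
  by move=> /(pP s).2; rewrite /xs /ys; lra.
pose u n : R := (ys n%:R - n%:R * xs n%:R) +
        (ys (- n%:R) - - n%:R * xs (- n%:R)) - 2 * A * n%:R.
have cu : cvgn u.
  (* Raising the modulus of the slope by 1 raises [h] by at most [A] on each side, which the term
     [2 * A * n] compensates; testing with [(A, y0)] and its opposite gives the lower bound 0. *)
  apply: nonincreasing_is_cvgn.
    apply/nonincreasing_seqP => n; rewrite /u.
    have := smax n%:R _ (smem n.+1%:R); have := smax (- n%:R) _ (smem (- n.+1%:R)).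
    have := leA _ (smem n.+1%:R); have := leA _ (smem (- n.+1%:R)).
    rewrite /= !ler_norml -natr1 => /andP[a1 a2] /andP[a3 a4].
    by move: (n%:R) a1 a2 a3 a4 => N; lra.
  exists 0 => _ [n _ <-]; have := smax n%:R _ (symL _ Ay); have := smax (- n%:R) _ Ay.
  by rewrite /u /=; lra.
by exists A, (limn u), xs, ys; split => //; exists y0.
Qed.

(** For nonnegative weights, combining maximizers of a linear form gives a maximizer on the
    combination. As [support_data] accepts any choice of maximizers, no tie-breaking has to be
    matched. *)
Lemma support_data_minkowski (R : realType) (m : nat) (K : 'I_m -> set (R * R))
    (A V : 'I_m -> R) (xs ys : 'I_m -> R -> R) (lam : 'I_m -> R) :
  (forall i, support_data (K i) (A i) (V i) (xs i) (ys i)) ->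
  (forall i, 0 <= lam i) ->
  support_data (minkowski_comb lam K) (\sum_(i < m) lam i * A i)
    (\sum_(i < m) lam i * V i) (fun s => \sum_(i < m) lam i * xs i s)
    (fun s => \sum_(i < m) lam i * ys i s).
Proof.
move=> KP lam0.
have hE s (x y : 'I_m -> R) : \sum_(i < m) lam i * y i - s * \sum_(i < m) lam i * x i =
    \sum_(i < m) lam i * (y i - s * x i).
  by rewrite mulr_sumr -sumrB; apply: eq_bigr => i _; ring.
split.
- by move=> s; exists (fun i => (xs i s, ys i s)); split => // i; exact: supp_mem (KP i) s.
- move=> s _ [x [Kx ->]] /=; rewrite !hE; apply: ler_sum => i _.
  by rewrite ler_wpM2l//; exact: supp_max (KP i) s _ (Kx i).
- move=> _ [x [Kx ->]] /=; apply: (le_trans (ler_norm_sum _ _ _)).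
  apply: ler_sum => i _; rewrite normrM ger0_norm// ler_wpM2l//.
  exact: fst_le (KP i) _ (Kx i).
- have /choice[y Ky] : forall i, exists y, K i (A i, y) by move=> i; exact: fst_max (KP i).
  by exists (\sum_(i < m) lam i * y i); exists (fun i => (A i, y i)).
- pose v (i : 'I_m) n : R := lam i * ((ys i n%:R - n%:R * xs i n%:R) +
        (ys i (- n%:R) - - n%:R * xs i (- n%:R)) - 2 * A i * n%:R).
  rewrite (_ : (fun n : nat => _) = fun n => \sum_(i < m) v i n); last first.
    apply/funext => n; rewrite !hE -mulrA mulr_suml mulr_sumr -big_split -sumrB/=.
    by apply: eq_bigr => i _; rewrite /v; ring.
  apply: (@cvg_big R^o) => [|i _]; first exact: add_continuous.
  by apply: cvgM; [exact: cvg_cst|exact: supp_cvg (KP i)].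
Qed.

(** A bounded set lies in a box of finite area, where the integrand is bounded. This is the source
    of finiteness for the coefficients. *)
Lemma even_moment_lty (R : realType) (L : set (R * R)) (A B : R) (n : nat) :
  measurable L -> (forall p, L p -> `|p.1| <= A) -> (forall p, L p -> `|p.2| <= B) ->
  (\int[@lebesgue2 R]_(p in L) (p.1 ^+ n.*2)%:E < +oo)%E.
Proof.
move=> mL LA LB.
have even_ge0 (t : R) : 0 <= t ^+ n.*2 by rewrite exprn_even_ge0// odd_double.
apply: (@le_lt_trans _ _ (\int[@lebesgue2 R]_(p in L) cst (A ^+ n.*2)%:E p)%E).
  apply: ge0_le_integral => //.
  - by move=> p _; rewrite lee_fin.
  - apply/measurable_funTS/measurable_EFinP/measurable_funX; exact: measurable_fst.
  - move=> p Lp; rewrite /= lee_fin -(ger0_norm (even_ge0 p.1)) normrX.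
    by rewrite lerXn2r ?nnegrE// ?LA// (le_trans _ (LA _ Lp)).
rewrite integral_cst//= lte_mul_pinfty ?lee_fin//.
have sub : L `<=` `[- A, A] `*` `[- B, B].
  by move=> p Lp; split => /=; rewrite in_itv/= -ler_norml ?LA ?LB.
have := le_measure (@lebesgue2 R) _ _ sub; rewrite !inE => /(_ mL) le.
apply: (le_lt_trans (le _)).
  by apply: measurableX; exact: measurable_itv.
have boxE := @product_measure1E _ _ _ _ R (@lebesgue_measure R) (@lebesgue_measure R) _ _
  (measurable_itv `[- A, A]) (measurable_itv `[- B, B]).
rewrite [ltLHS]boxE.
by rewrite /= !lebesgue_measure_itv/=; do 2 case: ifP => _; rewrite -?EFinB -?EFinM ?mule0 ?mul0e ?ltry.
Qed.

(** * Even moments of a Minkowski combination as polynomials with nonnegative coefficients *)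

Section moment_form.
Variables (R : realType) (m : nat) (K : 'I_m -> set (R * R)).
Hypothesis cK : forall i, compact (K i).
Hypothesis convK : forall i, convex_set2 (K i).
Hypothesis symK : forall i p, K i p -> K i (vopp p).

Lemma convex_minkowski_comb (lam : 'I_m -> R) : convex_set2 (minkowski_comb lam K).
Proof.
move=> _ _ [x [Kx ->]] [y [Ky ->]] t t0 t1.
exists (fun i => vadd (vscale t (x i)) (vscale (1 - t) (y i))); split.
  by move=> i; exact: convK.
rewrite /vadd /vscale/= !mulr_sumr -!big_split/=.
by congr pair; apply: eq_bigr => i _; ring.
Qed.

Lemma vopp_minkowski_comb (lam : 'I_m -> R) p :
  minkowski_comb lam K p -> minkowski_comb lam K (vopp p).
Proof.
move=> [x [Kx ->]]; exists (fun i => vopp (x i)); split; first by move=> i; exact: symK.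
by rewrite /vopp/= -!sumrN; congr pair; apply: eq_bigr => i _; rewrite mulrN.
Qed.

(* The coefficients of the even moments are the integrals over [s] of
   [\prod_j A (f j) - \prod_j xs (f j) s], which [fst_le] makes nonnegative. *)
Lemma even_moment_minkowski_comb (n : nat) : (forall i, K i !=set0) ->
  exists C : {ffun 'I_n.*2.+2 -> 'I_m} -> R, (forall f, 0 <= C f) /\
    forall lam : 'I_m -> R, (forall i, 0 <= lam i) ->
    (\int[@lebesgue2 R]_(p in minkowski_comb lam K) (p.1 ^+ n.*2)%:E =
      (\sum_f C f * \prod_(j < n.*2.+2) lam (f j))%:E)%E.
Proof.
move=> K0.
have dataK i := support_data_exists (@cK i) (K0 i) (@symK i).
have [A /choice[V /choice[xs /choice[ys KP]]]] := choice dataK.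
have V0 i : 0 <= V i.
  have D := KP i; exact: (edge_length_ge0 (@symK i) (supp_max D) (fst_max D) (supp_cvg D)).
have xA i s : `|xs i s| <= A i by exact: (fst_le (KP i) (supp_mem (KP i) s)).
have A0 i : 0 <= A i by exact: le_trans (normr_ge0 _) (xA i 0).
have mxs i : measurable_fun setT (xs i).
  have D := KP i; exact: (measurable_abscissa (supp_mem D) (supp_max D)).
pose D (f : {ffun 'I_n.*2.+2 -> 'I_m}) s : R :=
  \prod_j A (f j) - \prod_j xs (f j) s.
have D0 f s : 0 <= D f s.
  rewrite subr_ge0 (le_trans (ler_norm _))// normr_prod.
  by apply: ler_prod => j _; rewrite normr_ge0 xA.
have mD f : measurable_fun setT (fun s => (D f s)%:E).
  apply/measurable_EFinP; apply: measurable_funB => //.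
  exact: measurable_prod.
(* One slot carries [V] and the remaining 2n + 1 carry [A], so that the edge term is a product of 2n
   + 2 linear forms like the other one. *)
pose g (j : 'I_n.*2.+2) i : R := if j == ord0 then V i else A i.
pose c1 : R := 2 / n.*2.+1%:R; pose c2 : R := 2 / (n.*2.+1%:R * n.*2.+2%:R).
have c10 : 0 <= c1 by rewrite divr_ge0.
have c20 : 0 < c2 by rewrite divr_gt0// mulr_gt0// ltr0n.
pose E f := (\int[@lebesgue_measure R]_s (D f s)%:E)%E.
have E0 f : (0 <= E f)%E by apply: integral_ge0 => s _; rewrite lee_fin.
have main lam : (forall i, 0 <= lam i) ->
    (\int[@lebesgue2 R]_(p in minkowski_comb lam K) (p.1 ^+ n.*2)%:E =
     (c1 * \sum_(f : {ffun 'I_n.*2.+2 -> 'I_m}) (\prod_j g j (f j)) * \prod_j lam (f j))%:E +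
     c2%:E * \sum_(f : {ffun 'I_n.*2.+2 -> 'I_m}) (\prod_j lam (f j))%:E * E f)%E.
  move=> lam0; have L := support_data_minkowski KP lam0.
  rewrite (integral_even_moment (@convex_minkowski_comb lam)
    (@vopp_minkowski_comb lam) (compact_measurable2 (compact_minkowski_comb (lam := lam) (@cK)))
    (supp_mem L) (supp_max L) (fst_le L) (fst_max L) (supp_cvg L)).
  congr (_ + _ * _)%E.
    congr EFin; rewrite -mulrA; congr (_ * _).
    rewrite -prod_linear_forms big_ord_recl/= mulrC; congr (_ * _).
    by rewrite /g/= prodr_const card_ord.
  (* The difference of powers is expanded pointwise; each summand [D f s] is nonnegative, which
     permits exchanging sum and integral before finiteness is known. *)
  transitivity (\int[@lebesgue_measure R]_s
      (\sum_(f : {ffun 'I_n.*2.+2 -> 'I_m}) (\prod_j lam (f j))%:E * (D f s)%:E))%E.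
    apply: eq_integral => s _.
    under [RHS]eq_bigr do rewrite -EFinM.
    rewrite sumEFin; congr EFin.
    have pw (u : 'I_m -> R) : (\sum_(i < m) lam i * u i) ^+ n.*2.+2 =
        \sum_(f : {ffun 'I_n.*2.+2 -> 'I_m}) (\prod_j u (f j)) * \prod_j lam (f j).
      by rewrite -(prod_linear_forms (fun=> u)) prodr_const card_ord.
    by rewrite !pw -sumrB; apply: eq_bigr => f _; rewrite /D; ring.
  have l0 (f : {ffun 'I_n.*2.+2 -> 'I_m}) : 0 <= \prod_j lam (f j) by exact: prodr_ge0.
  rewrite ge0_integral_sum; last 3 first.
  - exact: measurableT.
  - move=> f; exact: (measurable_funeM _ (mD f)).
  - by move=> f s _; rewrite mule_ge0// lee_fin.
  apply: eq_bigr => f _; rewrite ge0_integralZl ?lee_fin//; first exact: mD.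
  by move=> s _; rewrite lee_fin.
(* Evaluation at all weights equal to 1: the moment of a bounded set is finite, every term on the
   right is nonnegative, and [E f] appears there with the positive factor [c2], so it cannot be
   infinite. *)
have Efin f : E f \is a fin_num.
  rewrite ge0_fin_numE//.
  have one0 (i : 'I_m) : 0 <= (1 : R) by [].
  have L := support_data_minkowski KP one0.
  have Lsym := @vopp_minkowski_comb (fun=> 1).
  have := even_moment_lty n (compact_measurable2 (compact_minkowski_comb (lam := fun=> 1) (@cK)))
    (fst_le L) (ordinate_le Lsym (supp_max L)).
  rewrite main//.
  rewrite !ltey; apply: contra => /eqP Ef.
  rewrite (_ : (\sum_f' _)%E = +oo%E) ?gt0_muley ?addey//.
  rewrite (bigD1 f)//= Ef big1// mul1e addye// -ltNye.
  apply: (@lt_le_trans _ _ 0%E) => //.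
  by apply: sume_ge0 => f' _; rewrite mule_ge0// lee_fin prodr_ge0.
exists (fun f : {ffun 'I_n.*2.+2 -> 'I_m} => c1 * \prod_j g j (f j) + c2 * fine (E f)); split.
  move=> f; rewrite addr_ge0 ?mulr_ge0 ?(ltW c20) ?fine_ge0//.
  by apply: prodr_ge0 => j _; rewrite /g; case: ifP.
move=> lam lam0; rewrite main//.
under [X in (_ + _ * X)%E]eq_bigr => f _ do rewrite -(fineK (Efin f)) -EFinM.
rewrite sumEFin -EFinM -EFinD; congr EFin.
rewrite !mulr_sumr -big_split/=; apply: eq_bigr => f _; ring.
Qed.

End moment_form.

(** * Passage from the first coordinate to an arbitrary non-vertical linear form *)

Lemma shear_inj (R : realType) (c : R) : injective (shear c).
Proof. by move=> [x y] [x' y'] [/= + yy']; rewrite yy' => /addIr ->. Qed.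

Lemma continuous_shear (R : realType) (c : R) : continuous (shear c).
Proof.
move=> p; have c1 := @continuous_linear_form2 R 1 c p.
have c2 := @continuous_linear_form2 R 0 1 p.
rewrite (_ : shear c = fun p => (1 * p.1 + c * p.2, 0 * p.1 + 1 * p.2)).
  exact: (cvg_pair c1 c2).
by apply/funext => s; rewrite /shear !mul1r mul0r add0r.
Qed.

Lemma minkowski_comb_shear (R : realType) (m : nat) (K : 'I_m -> set (R * R))
    (lam : 'I_m -> R) (c : R) :
  minkowski_comb lam (fun i => shear c @` K i) = shear c @` minkowski_comb lam K.
Proof.
have sumE (x : 'I_m -> R * R) :
    (\sum_(i < m) lam i * (shear c (x i)).1, \sum_(i < m) lam i * (shear c (x i)).2) =
    shear c (\sum_(i < m) lam i * (x i).1, \sum_(i < m) lam i * (x i).2).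
  rewrite /shear/= mulr_sumr -big_split/=; congr pair.
  by apply: eq_bigr => i _; ring.
apply/seteqP; split => [_ [x [Kx ->]]|_ [_ [x [Kx ->]] <-]].
  have /choice[y yP] : forall i, exists y, K i y /\ shear c y = x i.
    by move=> i; have [y] := Kx i; exists y.
  exists (\sum_(i < m) lam i * (y i).1, \sum_(i < m) lam i * (y i).2).
    by exists y; split => // i; exact: (yP i).1.
  by rewrite -sumE; congr pair; apply: eq_bigr => i _; rewrite (yP i).2.
exists (fun i => shear c (x i)); split; first by move=> i; exists (x i).
by rewrite sumE.
Qed.

Lemma integral_shear_image (R : realType) (c : R) (L : set (R * R)) (f : R * R -> \bar R) :
  measurable (shear c @` L) -> measurable_fun setT f -> (forall p, 0 <= f p)%E ->
  (\int[@lebesgue2 R]_(p in L) f (shear c p) =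
   \int[@lebesgue2 R]_(p in shear c @` L) f p)%E.
Proof.
move=> mL mf f0; rewrite integral_mkcond [RHS]integral_mkcond.
rewrite -(@ge0_integral_shear _ c (f \_ (shear c @` L))%E).
- apply: eq_integral => p _; rewrite !patchE.
  suff -> : (shear c p \in shear c @` L) = (p \in L) by [].
  apply/idP/idP; rewrite !inE; last by exists p.
  by move=> [p' Lp' /shear_inj <-].
- by apply/(measurable_restrictT _ mL); exact: measurable_funS mf.
- by move=> p; rewrite patchE; case: ifP.
Qed.

(** The shear turns [p.1 + c * p.2] into the abscissa, preserves area, and, being linear, commutes
    with Minkowski combinations and keeps every hypothesis on the sets. *)
Lemma directional_moment_minkowski_comb (R : realType) (m : nat)
    (K : 'I_m -> set (R * R)) (c : R) (n : nat) :
  (forall i, compact (K i)) -> (forall i, convex_set2 (K i)) ->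
  (forall i p, K i p -> K i (vopp p)) -> (forall i, K i !=set0) ->
  exists C : {ffun 'I_n.*2.+2 -> 'I_m} -> R, (forall f, 0 <= C f) /\
    forall lam : 'I_m -> R, (forall i, 0 <= lam i) ->
    (\int[@lebesgue2 R]_(p in minkowski_comb lam K) ((p.1 + c * p.2) ^+ n.*2)%:E =
      (\sum_f C f * \prod_(j < n.*2.+2) lam (f j))%:E)%E.
Proof.
move=> cK convK symK K0; pose K' i := shear c @` K i.
have cK' i : compact (K' i).
  apply: continuous_compact; last exact: cK.
  exact/continuous_subspaceT/continuous_shear.
have convK' i : convex_set2 (K' i).
  move=> _ _ [x Kx <-] [y Ky <-] t t0 t1.
  exists (vadd (vscale t x) (vscale (1 - t) y)); first exact: convK.
  by rewrite /shear /vadd /vscale/=; congr pair; ring.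
have symK' i p : K' i p -> K' i (vopp p).
  move=> [x Kx <-]; exists (vopp x); first exact: symK.
  by rewrite /shear /vopp/=; congr pair; ring.
have K'0 i : K' i !=set0 by have [x Kx] := K0 i; exists (shear c x), x.
have [C [C0 CE]] := even_moment_minkowski_comb cK' convK' symK' n K'0.
exists C; split => // lam lam0; rewrite -CE// minkowski_comb_shear.
rewrite -(@integral_shear_image _ c _ (fun p => (p.1 ^+ n.*2)%:E))//.
- by rewrite -minkowski_comb_shear; apply: compact_measurable2; exact: compact_minkowski_comb.
- by apply/measurable_EFinP/measurable_funX; exact: measurable_fst.
- by move=> p; rewrite lee_fin exprn_even_ge0// odd_double.
Qed.

Unset Implicit Arguments.
(* The integral, as a function of lambda >= 0, equals a polynomial
   sum_e c_e * prod_i lambda_i^(e_i) (exponents bounded by some d) with c_e >= 0. *)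
Theorem theorem6p2 (R : realType) (m : nat) (K : 'I_m -> set (R * R)) (q : nat) :
  (forall i, compact (K i)) ->
  (forall i, convex_set2 (K i)) ->
  (forall i, centrally_symmetric (K i)) ->
  exists (d : nat) (c : {ffun 'I_m -> 'I_d.+1} -> R),
    (forall e, 0 <= c e) /\
    forall lam : 'I_m -> R, (forall i, 0 <= lam i) ->
      (\int[(@lebesgue2 R)]_(s in minkowski_comb lam K) ((sqnorm2 s) ^+ q)%:E)%E
      = (\sum_(e : {ffun 'I_m -> 'I_d.+1}) c e * \prod_(i < m) lam i ^+ e i)%:E.
Proof.
move=> cK convK symK.
have symK' i p : K i p -> K i (vopp p) by move=> Kp; rewrite -symK; exists p.
(* If some [K i] is empty, so is the combination, even when [lam i = 0]; the zero polynomial then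
   works. *)
have [K0|] := pselect (forall i, K i !=set0); last first.
  move=> /existsNP[i Ki]; exists 0%N, (fun=> 0); split => // lam _.
  have -> : minkowski_comb lam K = set0.
    by rewrite -subset0 => p [x [Kx _]]; apply: Ki; exists (x i).
  by rewrite integral_set0 big1// => e _; rewrite mul0r.
have [w [c [w0 wE]]] := @sqnorm_pow_sum_linear_pow R q.
have /choice[C CP] := fun j => directional_moment_minkowski_comb (c j) q cK convK symK' K0.
have C0 f : 0 <= \sum_j w j * C j f.
  by apply: sumr_ge0 => j _; rewrite mulr_ge0// (CP j).1.
have [d [d0 dE]] := collect_monomials C0.
exists q.*2.+2, d; split => // lam lam0; rewrite -dE.
have mL : measurable (minkowski_comb lam K).
  by apply: compact_measurable2; exact: compact_minkowski_comb.
have mf j : measurable_fun (minkowski_comb lam K)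
    (fun s : R * R => ((s.1 + c j * s.2) ^+ q.*2)%:E).
  apply/measurable_EFinP/measurable_funX/measurable_funTS.
  apply: measurable_funD; first exact: measurable_fst.
  by apply: measurable_funM => //; exact: measurable_snd.
have f0 j (s : R * R) : (0 <= ((s.1 + c j * s.2) ^+ q.*2)%:E)%E.
  by rewrite lee_fin exprn_even_ge0// odd_double.
transitivity (\int[@lebesgue2 R]_(s in minkowski_comb lam K)
    \sum_(j < q.*2.+1) (w j)%:E * ((s.1 + c j * s.2) ^+ q.*2)%:E)%E.
  apply: eq_integral => s _; rewrite /sqnorm2 wE -sumEFin.
  by apply: eq_bigr => j _; rewrite EFinM.
rewrite ge0_integral_sum//; last 2 first.
- by move=> j; exact: (measurable_funeM _ (mf j)).
- by move=> j s _; rewrite mule_ge0// lee_fin.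
transitivity (\sum_(j < q.*2.+1)
    (w j * \sum_f C j f * \prod_(k < q.*2.+2) lam (f k))%:E)%E.
  by apply: eq_bigr => j _; rewrite EFinM -(CP j).2//; apply: ge0_integralZl => //; [exact: mf|rewrite lee_fin].
rewrite sumEFin; congr EFin; under eq_bigr do rewrite mulr_sumr.
rewrite exchange_big/=; apply: eq_bigr => f _; rewrite mulr_suml.
by apply: eq_bigr => j _; rewrite mulrA.
Qed.
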